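(* Let $p$ be a prime such that $p\neq 2$ and $p\neq 5$. Then $$\lvert F(p-\epsilon)\rvert_p = \left\lvert \frac{\phi}{\omega(\phi)} - 1\right\rvert_p .$$
   Context: $F(n)_{n\ge0}$ is the Fibonacci sequence: $F(0)=0$, $F(1)=1$, $F(n+2)=F(n+1)+F(n)$. For a prime $p\ne 5$, $\epsilon = 1$ if $p\equiv 1,4 \pmod 5$ and $\epsilon=-1$ if $p\equiv 2,3\pmod 5$. $K=\mathbb{Q}_p(\sqrt5)$, with a fixed square root $\sqrt 5$ of $5$; so $K=\mathbb{Q}_p$ if $p\equiv 1,4\pmod 5$, and $K$ is a quadratic extension of $\mathbb{Q}_p$ if $p\equiv 2,3\pmod 5$. $\lvert\cdot\rvert_p$ is the $p$-adic absolute value on $K$ extending the usual one on $\mathbb{Q}$ (with $\lvert p\rvert_p=1/p$). $\mathcal{O}_K=\{x\in K:\lvert x\rvert_p\le 1\}$, and $p^f$ is the size of the residue field $\mathcal{O}_K/\{x\in K:\lvert x\rvert_p<1\}$; for $p \neq 5$, $f=1$ if $p\equiv 1,4 \pmod 5$ and $f=2$ if $p\equiv 2,3\pmod 5$. $\phi=\frac{1+\sqrt5}{2}\in\mathcal{O}_K$. For $x\in K$ with $\lvert x\rvert_p=1$ (and $p\ne5$), $\omega(x)\in\mathcal{O}_K$ denotes the unique $(p^f-1)$th root of unity satisfying $\omega(x)\equiv x \pmod p$, i.e. $\lvert \omega(x) - x\rvert_p<1$. *)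

(* Defs.v *)
From HB Require Import structures.
From mathcomp Require Import all_boot all_order all_algebra all_field.
From mathcomp Require Import boolp classical_sets functions cardinality reals.
Set Implicit Arguments.
Unset Strict Implicit.
Unset Printing Implicit Defensive.
Import Order.TTheory GRing.Theory Num.Theory.
Local Open Scope classical_set_scope.
Local Open Scope card_scope.
Local Open Scope ring_scope.

Fixpoint fib (n : nat) : nat :=
  match n with
  | 0 => 0
  | 1 => 1
  | (m.+1 as k).+1 => fib k + fib m
  end%N.

(* Meaningful for a prime p <> 5, where p %% 5 is one of 1, 2, 3, 4. *)
Definition epsilon (p : nat) : int :=
  if (p %% 5 == 1)%N || (p %% 5 == 4)%N then 1 else -1.

Definition padic_val (p : nat) (q : rat) : int :=
  (logn p `|numq q|%N)%:Z - (logn p `|denq q|%N)%:Z.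

Definition padic_abs (R : realType) (p : nat) (q : rat) : R :=
  if q == 0 then 0 else p%:R ^ (- padic_val p q).

Record is_nonarch_abs (R : realType) (F : fieldType) (v : F -> R) : Prop := {
  nonarch_ge0 : forall x, 0 <= v x ;
  nonarch_eq0 : forall x, v x = 0 <-> x = 0 ;
  nonarch_mul : forall x y, v (x * y) = v x * v y ;
  nonarch_add : forall x y, v (x + y) <= Num.max (v x) (v y)
}.

(* (F, v) is a completion of the rational numbers for the p-adic absolute
   value.  This determines Q_p with its absolute value up to a unique
   isometric isomorphism.  Once v extends the p-adic absolute value, F has
   characteristic 0, so that ratr embeds rat into F. *)
Record is_Qp (R : realType) (p : nat) (F : fieldType) (v : F -> R) : Prop := {
  Qp_abs : is_nonarch_abs v ;
  Qp_extends : forall q : rat, v (ratr q) = padic_abs R p q ;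
  Qp_dense : forall (x : F) (e : R), 0 < e -> exists q : rat, v (x - ratr q) < e ;
  Qp_complete : forall u : nat -> F,
    (forall e : R, 0 < e -> exists N : nat, forall m n : nat,
      (N <= m)%N -> (N <= n)%N -> v (u m - u n) < e) ->
    exists l : F, forall e : R, 0 < e -> exists N : nat, forall n : nat,
      (N <= n)%N -> v (u n - l) < e
}.

(* K = Qp(sqrt5), where sqrt5 is a fixed square root of 5 and v is the absolute
   value of K extending the absolute value vp of Qp.  The degree of K over Qp
   is 1 when 5 is a square in Qp, and 2 otherwise. *)
Record is_Qp_sqrt5 (R : realType) (Qp : fieldType) (vp : Qp -> R)
    (K : fieldExtType Qp) (v : K -> R) (sqrt5 : K) : Prop := {
  sqrt5_sqr : sqrt5 ^+ 2 = 5%:R ;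
  sqrt5_gen : <<1; sqrt5>>%VS = fullv ;
  sqrt5_abs : is_nonarch_abs v ;
  sqrt5_extends : forall a : Qp, v (a%:A) = vp a
}.

Definition valuation_ring (R : realType) (K : fieldType) (v : K -> R) : set K :=
  [set x | v x <= 1].

(* The residue field as the set of cosets x + {z | v z < 1} of the maximal
   ideal in the valuation ring. *)
Definition residue_field (R : realType) (K : fieldType) (v : K -> R) :
    set (set K) :=
  [set [set y | v (y - x) < 1] | x in valuation_ring v].

(* The f such that the residue field has p ^ f elements (0 if there is none). *)
Definition residue_degree (R : realType) (p : nat) (K : fieldType)
    (v : K -> R) : nat :=
  xget 0%N [set f : nat | residue_field v #= `I_(p ^ f)%N].

(* The Teichmueller representative of x (0 if there is none). *)
Definition omega (R : realType) (p : nat) (K : fieldType) (v : K -> R)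
    (x : K) : K :=
  xget 0 [set w : K | w ^+ (p ^ residue_degree p v - 1)%N = 1 /\ v (w - x) < 1].

Definition phi (K : fieldType) (sqrt5 : K) : K := (1 + sqrt5) / 2%:R.

(* Main.v *)
Require Import Defs.
From HB Require Import structures.
From mathcomp Require Import all_boot all_order all_algebra all_field.
From mathcomp Require Import boolp classical_sets functions cardinality reals.
From mathcomp Require Import cyclic ring lra zify.
Set Implicit Arguments.
Unset Strict Implicit.
Unset Printing Implicit Defensive.
Import Order.TTheory GRing.Theory Num.Theory.
Local Open Scope ring_scope.

(** Write [a = phi] and [b = -1/a] for its conjugate, so that
    [F(n) sqrt5 = a^n - b^n].  Since [sqrt5] and [a] are units and [n = p - epsilon]
    is even, [|F(n)| = |a^(2n) - 1|].  Over a field of characteristic [p] with a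
    primitive fifth root of unity, Frobenius fixes or exchanges the roots of
    [X^2 - X - 1] according to [epsilon], which gives [p | F(n)], so [a^(2n)] is
    congruent to 1 and hence [omega(a)^(2n) = 1].  Thus [|F(n)| = |u^(2n) - 1|]
    with [u = a / omega(a)] congruent to 1, and this is [|u - 1|] because [p] does
    not divide [2n].

    That [omega(a)] exists takes the residue field and the completeness of [K]:
    either [sqrt5] lies in [Qp], or it is congruent to no element of [Qp] by
    Newton's iteration, and then [|x + y sqrt5| = max(|x|, |y|)]. *)

(** * Ultrametric estimates and Newton's iteration *)

Lemma expr_lt_eps (R : realType) (a e : R) :
  0 <= a < 1 -> 0 < e -> exists N, forall n, (N <= n)%N -> a ^+ n < e.
Proof.
move=> /andP[a0 a1] e0.
have [->|an0] := eqVneq a 0.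
  by exists 1%N => -[|n] // _; rewrite expr0n.
have ap : 0 < a by rewrite lt_def an0.
pose d := a^-1 - 1.
have dp : 0 < d by rewrite subr_gt0 invf_gt1.
have bern n : 1 + n%:R * d <= (a^-1) ^+ n.
  elim: n => [|n IHn]; first by rewrite mul0r addr0 expr0.
  rewrite exprS; apply: le_trans (ler_wpM2l _ IHn); last by rewrite invr_ge0.
  have -> : a^-1 = 1 + d by rewrite /d; ring.
  have h : 0 <= n%:R * d * d by rewrite !mulr_ge0 // ?ler0n // ltW.
  by rewrite -natr1; nra.
pose N := Num.bound (e^-1 / d).
exists N => n leNn.
rewrite -[a ^+ n]invrK -exprVn invf_plt ?posrE ?exprn_gt0 ?invr_gt0 //.
apply: lt_le_trans (bern n); apply: ltr_pwDl => //.
rewrite -ler_pdivrMr //; apply: le_trans (_ : N%:R <= _); last by rewrite ler_nat.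
by apply/ltW/archi_boundP; rewrite divr_ge0 // ?invr_ge0 ltW.
Qed.

(** Shaped so that [Qp_complete] is itself a proof of [cauchy_complete vp]; for [K], completeness
    has to be derived. *)
Definition is_cauchy (R : realType) (F : zmodType) (v : F -> R) (u : nat -> F) :=
  forall e : R, 0 < e -> exists N : nat, forall m n : nat,
    (N <= m)%N -> (N <= n)%N -> v (u m - u n) < e.

Definition cauchy_complete (R : realType) (F : zmodType) (v : F -> R) :=
  forall u : nat -> F, is_cauchy v u ->
    exists l : F, forall e : R, 0 < e -> exists N : nat, forall n : nat,
      (N <= n)%N -> v (u n - l) < e.

Section NonarchimedeanAbs.
Variables (R : realType) (F : fieldType) (v : F -> R).
Hypothesis hv : is_nonarch_abs v.
Implicit Types (x y : F) (m n : nat) (c e : R).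

Let v_ge0 := nonarch_ge0 hv.
Let vM := nonarch_mul hv.

Lemma abs0 : v 0 = 0. Proof. exact/(nonarch_eq0 hv). Qed.

Lemma abs_neq0 x : x != 0 -> v x != 0.
Proof. by move=> /eqP nx; apply/eqP => /(nonarch_eq0 hv). Qed.

Lemma abs_gt0 x : x != 0 -> 0 < v x.
Proof. by move=> nx; rewrite lt_def abs_neq0 ?v_ge0. Qed.

Lemma abs1 : v 1 = 1.
Proof.
have n1 : v 1 != 0 by apply: abs_neq0; exact: oner_neq0.
by apply: (mulfI n1); rewrite -vM !mulr1.
Qed.

Lemma absX x n : v (x ^+ n) = v x ^+ n.
Proof. by elim: n => [|n IHn]; rewrite ?expr0 ?abs1 // !exprS vM IHn. Qed.

Lemma abs_expr_eq1 x n : (0 < n)%N -> (v (x ^+ n) == 1) = (v x == 1).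
Proof. by move=> n0; rewrite absX pexprn_eq1 // gtn_eqF. Qed.

Lemma absN x : v (- x) = v x.
Proof.
have /eqP vN1 : v (-1) == 1 by rewrite -(@abs_expr_eq1 _ 2) // sqrrN expr1n abs1.
by rewrite -mulN1r vM vN1 mul1r.
Qed.

Lemma absV x : v x^-1 = (v x)^-1.
Proof.
have [->|nx] := eqVneq x 0; first by rewrite invr0 abs0 invr0.
by apply: (mulfI (abs_neq0 nx)); rewrite -vM !divff ?abs1 ?abs_neq0.
Qed.

Lemma abs_distC x y : v (x - y) = v (y - x).
Proof. by rewrite -opprB absN. Qed.

Lemma absD_le x y c : v x <= c -> v y <= c -> v (x + y) <= c.
Proof.
by move=> hx hy; apply: le_trans (nonarch_add hv x y) _; rewrite ge_max hx.
Qed.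

Lemma absD_lt x y c : v x < c -> v y < c -> v (x + y) < c.
Proof.
by move=> hx hy; apply: le_lt_trans (nonarch_add hv x y) _; rewrite gt_max hx.
Qed.

Lemma absB_le x y c : v x <= c -> v y <= c -> v (x - y) <= c.
Proof. by move=> hx hy; apply: absD_le => //; rewrite absN. Qed.

Lemma absB_lt x y c : v x < c -> v y < c -> v (x - y) < c.
Proof. by move=> hx hy; apply: absD_lt => //; rewrite absN. Qed.

Lemma abs_sum_lt (I : Type) (r : seq I) (E : I -> F) c :
  0 < c -> (forall i, v (E i) < c) -> v (\sum_(i <- r) E i) < c.
Proof.
move=> c0 hE; elim/big_ind: _ => [|x y|i _] //; first by rewrite abs0.
exact: absD_lt.
Qed.

Lemma absM_le1 x y : v x <= 1 -> v y <= 1 -> v (x * y) <= 1.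
Proof. by move=> hx hy; rewrite vM mulr_ile1. Qed.

Lemma absX_le1 x n : v x <= 1 -> v (x ^+ n) <= 1.
Proof. by move=> hx; rewrite absX exprn_ile1. Qed.

Lemma abs_nat_le1 n : v n%:R <= 1.
Proof.
elim: n => [|n IHn]; first by rewrite abs0.
by rewrite -natr1; apply: absD_le; rewrite ?abs1.
Qed.

Lemma abs_le1_near x y : v (x - y) < 1 -> v y <= 1 -> v x <= 1.
Proof. by move=> hxy hy; rewrite -(subrK y x); apply: absD_le => //; exact: ltW. Qed.

Lemma abs_eq1_near x y : v (x - y) < 1 -> v y = 1 -> v x = 1.
Proof.
move=> hxy hy; apply/le_anti; rewrite (abs_le1_near hxy) ?hy //= leNgt.
by apply/negP => hx; have := absB_lt hx hxy; rewrite subKr hy ltxx.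
Qed.

Lemma abs_subX_le x y n : v x <= 1 -> v y <= 1 -> v (x ^+ n - y ^+ n) <= v (x - y).
Proof.
move=> hx hy; rewrite subrXX vM ler_piMr //.
elim/big_ind: _ => [|? ?|i _]; first by rewrite abs0.
  exact: absD_le.
by rewrite absM_le1 ?absX_le1.
Qed.

Lemma abs_subX_lt1 x y n : v x <= 1 -> v y <= 1 -> v (x - y) < 1 ->
  v (x ^+ n - y ^+ n) < 1.
Proof. by move=> hx hy; apply: le_lt_trans; apply: abs_subX_le. Qed.

(** In [x^n - 1 = (x - 1)(1 + x + ... + x^(n-1))] every power of [x] is congruent to 1, so the
    cofactor is congruent to the unit [n]. *)
Lemma abs_expr_sub1 x n : v (x - 1) < 1 -> v n%:R = 1 ->
  v (x ^+ n - 1) = v (x - 1).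
Proof.
move=> hx hn; rewrite subrX1 vM; suff -> : v (\sum_(i < n) x ^+ i) = 1 by rewrite mulr1.
have v1 := abs1; have hx1 : v x <= 1 by apply: (abs_le1_near hx); rewrite v1.
apply: (abs_eq1_near _ hn); rewrite -[n in n%:R]card_ord -sumr_const -sumrB.
apply: abs_sum_lt => // i.
by rewrite -[X in _ - X](expr1n _ i); apply: abs_subX_lt1; rewrite ?v1.
Qed.

(** Will turn the congruence of [omega(phi)^(2n)] to 1 into an equality. *)
Lemma root1_near1 x n : x ^+ n = 1 -> v n%:R = 1 -> v (x - 1) < 1 -> x = 1.
Proof.
move=> hx hn /abs_expr_sub1/(_ hn); rewrite hx subrr abs0.
by move=> /esym/(nonarch_eq0 hv)/subr0_eq.
Qed.

(** By induction on [n]: multiplying by [x + h] carries the remainder along and adds only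
    [n x^(n-1) h^2], where everything but [h^2] is integral. *)
Lemma abs_exprD_taylor x h n : v x <= 1 -> v h <= 1 ->
  v ((x + h) ^+ n - x ^+ n - n%:R * x ^+ n.-1 * h) <= v h ^+ 2.
Proof.
move=> hx hh; have h2 : 0 <= v h ^+ 2 by rewrite exprn_ge0.
elim: n => [|n IHn]; first by rewrite !expr0 subrr !mul0r subrr abs0.
rewrite (_ : _ - _ = (x + h) * ((x + h) ^+ n - x ^+ n - n%:R * x ^+ n.-1 * h)
    + (n%:R * x ^+ n.-1) * h ^+ 2); last first.
  (* At [n = 0] the truncated exponent [n.-1] is harmless, since its coefficient is 0. *)
  case: n {IHn} => [|n]; first by rewrite !exprS !expr0 /=; ring.
  by rewrite -natr1 /= !exprS; ring.
apply: absD_le; rewrite vM.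
  apply: le_trans (IHn); rewrite ler_piMl //.
  exact: absD_le.
by rewrite absX ler_piMl // absM_le1 ?abs_nat_le1 ?absX_le1.
Qed.

(** By the ultrametric inequality a difference of far terms is bounded by the largest increment
    between them, so no geometric series has to be summed. *)
Lemma linear_cauchy (u : nat -> F) c : 0 <= c < 1 ->
  (forall n, v (u n.+1 - u n) <= c ^+ n) ->
  is_cauchy v u.
Proof.
move=> c01 hu e e0; have [c0 c1] := andP c01.
have [N hN] := expr_lt_eps c01 e0; exists N.
have key n : (N <= n)%N -> v (u n - u N) < e.
  move=> /subnK <-; elim: (n - N)%N => [|k IHk]; first by rewrite subrr abs0.
  rewrite -(subrKA (u (k + N)%N)) addSn; apply: absD_lt => //.
  by apply: le_lt_trans (hu _) (hN _ _); rewrite leq_addl.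
move=> m n hm hn; rewrite -(subrKA (u N)); apply: absD_lt; first exact: key.
by rewrite abs_distC; apply: key.
Qed.

(* Newton's iteration for [X ^ n - a]: the error is at least squared at each
   step. *)
Lemma hensel_root (a x : F) n : cauchy_complete v ->
  (0 < n)%N -> v n%:R = 1 -> v x = 1 -> v (x ^+ n - a) < 1 ->
  exists w, w ^+ n = a /\ v (w - x) < 1.
Proof.
move=> cv n0 hn hx; set c := v _ => c1.
have c0 : 0 <= c by exact: v_ge0.
pose step y := y - (y ^+ n - a) / (n%:R * y ^+ n.-1).
pose u k := iter k step x.
have stepP y : v y = 1 -> v (y ^+ n - a) <= c ->
    [/\ v (step y - y) = v (y ^+ n - a), v (step y) = 1 &
        v (step y ^+ n - a) <= v (y ^+ n - a) ^+ 2].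
  move=> hy hya; pose h := - ((y ^+ n - a) / (n%:R * y ^+ n.-1)).
  have nz : n%:R * y ^+ n.-1 != 0 :> F.
    apply/eqP => /(congr1 v); rewrite abs0 vM absX hn hy expr1n mulr1.
    by apply/eqP; rewrite oner_eq0.
  have vh : v h = v (y ^+ n - a).
    by rewrite absN vM absV vM absX hn hy expr1n mulr1 invr1 mulr1.
  have hh1 : v h < 1 by rewrite vh; apply: le_lt_trans c1.
  have -> : step y = y + h by [].
  split; first by rewrite addrC addKr.
    by apply: abs_eq1_near hy; rewrite addrC addKr.
  (* The correction [h] makes the linear term [n y^(n-1) h] equal to [a - y^n], so the new error is
     exactly the Taylor remainder. *)
  rewrite -vh (_ : _ - a = (y + h) ^+ n - y ^+ n - n%:R * y ^+ n.-1 * h).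
    by apply: abs_exprD_taylor; rewrite ?hy // ltW.
  have -> : n%:R * y ^+ n.-1 * h = a - y ^+ n by rewrite /h mulrN mulrC divfK // opprB.
  by ring.
have uP k : v (u k) = 1 /\ v (u k ^+ n - a) <= c ^+ k.+1.
  elim: k => [|k [IH1 IH2]]; first by rewrite expr1.
  have hc : c ^+ k.+1 <= c by rewrite exprS ler_piMr // exprn_ile1 // ltW.
  have [_ h1 h2] := stepP _ IH1 (le_trans IH2 hc).
  split=> //; apply: le_trans h2 _; rewrite expr2 [leRHS]exprS.
  by apply: ler_pM => //; apply: le_trans hc.
have uS k : v (u k.+1 - u k) <= c ^+ k.+1.
  have [h1 h2] := uP k.
  have hc : c ^+ k.+1 <= c by rewrite exprS ler_piMr // exprn_ile1 // ltW.
  by have [-> _ _] := stepP _ h1 (le_trans h2 hc).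
have /cv [l hl] : is_cauchy v u.
  apply: (@linear_cauchy _ c); first by rewrite c0.
  by move=> k; apply: le_trans (uS k) _; rewrite exprS ler_piMl ?exprn_ge0 // ltW.
have ux k : v (u k - x) < 1.
  elim: k => [|k IHk]; first by rewrite subrr abs0.
  rewrite -(subrKA (u k)); apply: absD_lt => //; apply: le_lt_trans (uS k) _.
  by rewrite exprn_ilt1.
exists l; split.
  (* If [l^n - a] were nonzero, then for large [N] both [l^n - u_N^n] and [u_N^n - a] would be
     smaller than it, although it is their sum. *)
  apply/eqP; rewrite -subr_eq0; apply/negPn/negP => nz.
  have [N1 hN1] := expr_lt_eps (introT andP (conj c0 c1)) (abs_gt0 nz).
  have [N0 hN0] := hl 1 ltr01.
  have [N2 hN2] := hl _ (abs_gt0 nz).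
  pose N := maxn N0 (maxn N1 N2).
  have [vuN huN] := uP N.
  have vl : v l <= 1.
    by apply: (@abs_le1_near _ (u N)); rewrite ?vuN // abs_distC hN0 // leq_maxl.
  suff : v (l ^+ n - a) < v (l ^+ n - a) by rewrite ltxx.
  rewrite -{1}(subrKA (u N ^+ n)); apply: absD_lt.
    apply: le_lt_trans (abs_subX_le _ vl _) _; first by rewrite vuN.
    by rewrite abs_distC hN2 // /N !leq_max leqnn !orbT.
  apply: le_lt_trans huN (hN1 _ _).
  by rewrite /N leqW // !leq_max leqnn !orbT.
have [N hN] := hl 1 ltr01.
rewrite -(subrKA (u N)); apply: absD_lt => //.
by rewrite abs_distC hN.
Qed.

End NonarchimedeanAbs.

(** * Fibonacci numbers and their divisibility by [p] *)

Lemma fib_binet (A : comNzRingType) (a b : A) n : a + b = 1 -> a * b = -1 ->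
  (fib n)%:R * (a - b) = a ^+ n - b ^+ n.
Proof.
move=> hD hM.
suff [] : (fib n)%:R * (a - b) = a ^+ n - b ^+ n /\
          (fib n.+1)%:R * (a - b) = a ^+ n.+1 - b ^+ n.+1 by [].
elim: n => [|n [IH1 IH2]]; first by rewrite !expr1 !expr0 mul0r subrr mul1r.
split=> //; rewrite [fib _]/= -/(fib n.+1) natrD mulrDl IH2 IH1.
have sq (c d : A) : c + d = 1 -> c * d = -1 -> c ^+ n.+2 = c ^+ n.+1 + c ^+ n.
  move=> h1 h2; have -> : c ^+ n.+2 = c ^+ n.+1 * (c + d) - c ^+ n * (c * d).
    by rewrite !exprS; ring.
  by rewrite h1 h2; ring.
by rewrite (sq a b) // (sq b a) ?(addrC b) ?(mulrC b) //; ring.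
Qed.

(** [L] is a splitting field of the fifth cyclotomic polynomial over [F_p]. *)
Lemma ex_root_cyclo5 p : prime p ->
  exists (L : fieldType) (z : L),
    p \in [pchar L] /\ 1 + z + z ^+ 2 + z ^+ 3 + z ^+ 4 = 0.
Proof.
move=> hp; pose q : {poly 'F_p} := Poly [:: 1; 1; 1; 1; 1].
have sq : size q = 5%N by rewrite (PolyK (c := 1)) //= oner_neq0.
have q0 : q != 0 by rewrite -size_poly_eq0 sq.
have [L [rs hrs _]] := FinSplittingFieldFor q0.
have [z zrs] : exists z, z \in rs.
  case: rs hrs => [|z rs] hrs; last by exists z; rewrite mem_head.
  by move: hrs => /eqp_size; rewrite big_nil size_poly1 size_map_poly sq.
exists L, z; split; first by rewrite (pchar_lalg L) pchar_Fp.
have : root (map_poly (GRing.in_alg L) q) z by rewrite (eqp_root hrs) root_prod_XsubC.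
rewrite rootE /q map_Poly ?rmorph0 // horner_Poly /= scale1r => /eqP <-.
by ring.
Qed.

Lemma prime_ndvd5 p : prime p -> p <> 5%N -> ~~ (p %| 5)%N.
Proof. by move=> hp /eqP hp5; rewrite dvdn_prime2. Qed.

Lemma prime_mod5 p : prime p -> p <> 5%N -> (p %% 5)%N \in [:: 1; 2; 3; 4]%N.
Proof.
move=> hp hp5; have : (p %% 5 < 5)%N by rewrite ltn_mod.
have : (p %% 5 != 0)%N.
  by rewrite -/(dvdn 5 p) dvdn_prime2 // eq_sym; apply/eqP.
by case: (p %% 5)%N => [|[|[|[|[|]]]]].
Qed.

(* With [z] a primitive fifth root of unity in characteristic [p], the roots of
   [X ^ 2 - X - 1] are [- (z ^ 2 + z ^ 3)] and [- (z + z ^ 4)]; Frobenius fixes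
   them or exchanges them according to [p] modulo 5. *)
Lemma dvdn_fib_prime p : prime p -> p <> 5%N -> (p %| fib `|p%:Z - epsilon p|)%N.
Proof.
move=> hp hp5; have [L [z [charL hz]]] := ex_root_cyclo5 hp.
have p1 := prime_gt1 hp.
have z5 : z ^+ 5 = 1.
  apply/eqP; rewrite -subr_eq0.
  have -> : z ^+ 5 - 1 = (z - 1) * (1 + z + z ^+ 2 + z ^+ 3 + z ^+ 4) by ring.
  by rewrite hz mulr0.
pose a := - (z ^+ 2 + z ^+ 3); pose b := - (z + z ^+ 4).
have hab : a + b = 1 by rewrite /a /b -[RHS]subr0 -hz; ring.
have hM : a * b = -1.
  have -> : a * b = z ^+ 3 + z ^+ 5 * z + z ^+ 4 + z ^+ 5 * z ^+ 2.
    by rewrite /a /b; ring.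
  by rewrite z5 -[RHS]add0r -hz; ring.
have ab0 : a - b != 0.
  apply/eqP => /(congr1 (fun x => x ^+ 2)); rewrite expr0n /=.
  have -> : (a - b) ^+ 2 = (a + b) ^+ 2 - 4%:R * (a * b) by ring.
  rewrite hab hM (_ : _ - _ = 5%:R); last by ring.
  by apply/eqP; rewrite -(dvdn_pcharf charL) prime_ndvd5.
have frobE (x y : L) : (- (x + y)) ^+ p = - (x ^+ p + y ^+ p).
  rewrite -!(pFrobenius_autE charL) pFrobenius_autN pFrobenius_autD_comm //.
  exact: mulrC.
have zX m r : (p * m)%N = r %[mod 5] -> (z ^+ m) ^+ p = z ^+ (r %% 5).
  move=> h; rewrite -exprM mulnC [in LHS](divn_eq (p * m) 5) exprD mulnC.
  by rewrite exprM z5 expr1n mul1r h.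
have nz x y : x * y = -1 :> L -> x != 0.
  by move=> h; apply/eqP => h0; move/eqP: h; rewrite h0 mul0r eq_sym oppr_eq0 oner_eq0.
have [a0 b0] : a != 0 /\ b != 0 by split; [apply: nz hM|apply: (nz b a); rewrite mulrC].
(* By Binet's formula in [L], where [a - b] is nonzero, [p] divides [F(n)] exactly when
   [a^n = b^n]. *)
rewrite (dvdn_pcharf charL) -(inj_eq (mulIf ab0)) mul0r fib_binet // subr_eq0.
(* For [epsilon = 1] Frobenius fixes both roots, so their [(p-1)]-th powers are 1; for
   [epsilon = -1] it exchanges them, so both [(p+1)]-th powers equal [a b]. *)
have fix_case : a ^+ p = a -> b ^+ p = b -> a ^+ p.-1 = b ^+ p.-1.
  have pred_eq1 (c : L) : c != 0 -> c ^+ p = c -> c ^+ p.-1 = 1.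
    by move=> c0 hc; apply: (mulIf c0); rewrite mul1r -exprSr prednK // ltnW.
  by move=> ha hb; rewrite !pred_eq1.
have swap_case : a ^+ p = b -> b ^+ p = a -> a ^+ p.+1 = b ^+ p.+1.
  by move=> ha hb; rewrite !exprS ha hb mulrC.
have n1 : `|p%:Z - 1%R|%N = p.-1 by lia.
have ppow m : (p * m = p %% 5 * m %[mod 5])%N by rewrite modnMml.
have := zX 1%N _ (ppow 1%N); rewrite expr1 => z1.
have z2 := zX 2%N _ (ppow 2%N).
have z3 := zX 3%N _ (ppow 3%N); have z4 := zX 4%N _ (ppow 4%N).
rewrite /epsilon; move: (p %% 5)%N (prime_mod5 hp hp5) z1 z2 z3 z4 => r.
rewrite !inE => /or4P[] /eqP -> /= z1 z2 z3 z4; rewrite ?n1 ?addn1; apply/eqP.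
- by apply: fix_case; rewrite frobE ?z1 ?z2 ?z3 ?z4.
- by apply: swap_case; rewrite frobE ?z1 ?z2 ?z3 ?z4 // addrC.
- by apply: swap_case; rewrite frobE ?z1 ?z2 ?z3 ?z4 // addrC.
- by apply: fix_case; rewrite frobE ?z1 ?z2 ?z3 ?z4 // addrC.
Qed.

(** * Arithmetic of the index [p - epsilon] *)

Section PrimeIndex.
Variable p : nat.
Hypotheses (hp : prime p) (hp2 : p <> 2%N).

Lemma index_cases : `|p%:Z - epsilon p|%N = p.-1 \/ `|p%:Z - epsilon p|%N = p.+1.
Proof. by have := prime_gt1 hp; rewrite /epsilon; case: ifP => _; lia. Qed.

Lemma odd_prime_neq2 : odd p.
Proof. by case: (even_prime hp). Qed.

Lemma odd_index : ~~ odd `|p%:Z - epsilon p|.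
Proof.
have := odd_prime_neq2; have := prime_gt0 hp.
by case: index_cases => ->; case: (p) => //= n _; rewrite negbK.
Qed.

(** The index is [-1] or [1] modulo [p], and [p] is odd. This makes [2n] a unit, as [abs_expr_sub1]
    requires. *)
Lemma ndvd_double_index : ~~ (p %| 2 * `|p%:Z - epsilon p|)%N.
Proof.
have p1 := prime_gt1 hp.
rewrite Euclid_dvdM // negb_or dvdn_prime2 //.
apply/andP; split; first exact/eqP.
case: index_cases => ->; first by rewrite gtnNdvd; lia.
by rewrite -addn1 dvdn_addr // dvdn1; lia.
Qed.

(** The index is one factor of [p^2 - 1 = (p - 1)(p + 1)], and the other factor is even. In the
    inert case this carries the congruence of [phi^(2n)] to 1 over to [phi^(p^2-1)]. *)
Lemma double_index_dvd : (2 * `|p%:Z - epsilon p| %| p ^ 2 - 1)%N.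
Proof.
have p1 := prime_gt1 hp; have podd := odd_prime_neq2.
have -> : (p ^ 2 - 1 = p.-1 * p.+1)%N by rewrite -mulnn; nia.
case: index_cases => ->; rewrite mulnC; last rewrite mulnC.
  by rewrite dvdn_pmul2l ?dvdn2 /= ?podd //; lia.
rewrite [X in (_ %| X)%N]mulnC mulnC dvdn_pmul2l // dvdn2.
by move: podd p1; case: (p) => //= n; rewrite negbK.
Qed.

End PrimeIndex.

(** * Residues of [Qp] modulo [p] *)

Section QpResidues.
Variables (R : realType) (p : nat) (Qp : fieldType) (vp : Qp -> R).
Hypotheses (hp : prime p) (hQp : is_Qp p vp).

Lemma Qp_abs_int_lt1 (n : int) : (vp n%:~R < 1) = (p %| `|n|)%N.
Proof.
have := Qp_extends hQp n%:~R; rewrite ratr_int => ->.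
rewrite /padic_abs intr_eq0; have [->|n0] := eqVneq n 0; first by rewrite ltr01 dvdn0.
have p1 : 1 < p%:R :> R by rewrite ltr1n prime_gt1.
rewrite /padic_val numq_int denq_int logn1 subr0 -exprnN invf_lt1; last first.
  by rewrite exprn_gt0 // (lt_trans ltr01).
rewrite -[p in RHS]expn1 pfactor_dvdn // ?absz_gt0 //.
by case: (logn _ _) => [|k]; rewrite ?expr0 ?ltxx // exprn_egt1.
Qed.

Lemma Qp_intr_eq0 (n : int) : (n%:~R == 0 :> Qp) = (n == 0).
Proof.
have [->|n0] := eqVneq n 0; first by rewrite eqxx.
apply/negP => /eqP h; have := Qp_extends hQp n%:~R.
rewrite ratr_int h (abs0 (Qp_abs hQp)) /padic_abs intr_eq0 (negPf n0) => /esym/eqP.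
by rewrite expfz_eq0 pnatr_eq0 (gtn_eqF (prime_gt0 hp)) andbF.
Qed.

Lemma Qp_abs_nat_lt1 n : (vp n%:R < 1) = (p %| n)%N.
Proof. by rewrite pmulrn Qp_abs_int_lt1. Qed.

Lemma Qp_abs_nat_eq1 n : (vp n%:R == 1) = ~~ (p %| n)%N.
Proof.
rewrite -Qp_abs_nat_lt1 -leNgt eq_le.
by rewrite (abs_nat_le1 (Qp_abs hQp)).
Qed.

Lemma Qp_residue_inj i j : (i < p)%N -> (j < p)%N -> vp (i%:R - j%:R) < 1 -> i = j.
Proof.
move=> hi hj; rewrite !pmulrn -rmorphB Qp_abs_int_lt1 => hd.
have [h0|h0] := posnP `|i%:Z - j%:Z|; first by lia.
have := dvdn_leq h0 hd; lia.
Qed.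

(** Density reduces this to a rational [q] with [|q| <= 1], whose denominator is prime to [p]; [k]
    is then the value of [q] in [F_p]. *)
Lemma Qp_residue x : vp x <= 1 -> exists2 k, (k < p)%N & vp (x - k%:R) < 1.
Proof.
have hv := Qp_abs hQp; move=> hx.
have [q hq] := Qp_dense hQp x ltr01.
have vq : vp (ratr q) <= 1 by apply: (abs_le1_near hv _ hx); rewrite abs_distC.
(* If [p] divided the denominator, it would not divide the numerator, and [|q|] would exceed 1. *)
have vden : vp (denq q)%:~R = 1.
  apply/eqP; rewrite -absz_denq -pmulrn Qp_abs_nat_eq1; apply/negP => hd.
  have hn : ~~ (p %| `|numq q|)%N.
    apply/negP => hn; have := coprime_num_den q.
    by rewrite /coprime => /eqP hg; have : (p %| 1)%N;
      [rewrite -hg dvdn_gcd hn | rewrite dvdn1 => /eqP h1; move: hp; rewrite h1].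
  move: vq; rewrite /ratr (nonarch_mul hv) (absV hv) leNgt => /negP; apply.
  rewrite -Qp_abs_int_lt1 -leNgt in hn.
  rewrite -Qp_abs_nat_lt1 pmulrn absz_denq in hd.
  have d0 : 0 < vp (denq q)%:~R.
    by apply: (abs_gt0 hv); rewrite Qp_intr_eq0 denq_neq0.
  apply: lt_le_trans (_ : (vp (denq q)%:~R)^-1 <= _); first by rewrite invf_gt1.
  by rewrite ler_peMl // invr_ge0 ltW.
have den0 : (denq q)%:~R != 0 :> 'F_p.
  by rewrite -(dvdz_pcharf (pchar_Fp hp)) dvdzE -Qp_abs_int_lt1 vden ltxx.
have [k hk] : exists k : 'F_p, k * (denq q)%:~R = (numq q)%:~R.
  by exists ((numq q)%:~R / (denq q)%:~R); rewrite divfK.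
exists k; first by rewrite -[X in (_ < X)%N](Fp_cast hp) ltn_ord.
rewrite -(subrKA (ratr q)); apply: (absD_lt hv) => //.
have : (p %| (numq q - (k : nat)%:Z * denq q)%R)%Z.
  rewrite (dvdz_pcharf (pchar_Fp hp)) rmorphB rmorphM /= -pmulrn natr_Zp.
  by rewrite hk subrr.
rewrite dvdzE -Qp_abs_int_lt1 rmorphB rmorphM /= -pmulrn => h.
have -> : ratr q - k%:R = ((numq q)%:~R - k%:R * (denq q)%:~R) / (denq q)%:~R :> Qp.
  by rewrite mulrBl mulfK // Qp_intr_eq0 denq_neq0.
by rewrite (nonarch_mul hv) (absV hv) vden invr1 mulr1.
Qed.

End QpResidues.

(** * Residue degree and Teichmueller representative *)

Lemma residue_degreeE (R : realType) (p f : nat) (K : fieldType) (v : K -> R)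
    (g : nat -> K) : is_nonarch_abs v -> (1 < p)%N ->
  (forall k, v (g k) <= 1) ->
  (forall x, v x <= 1 -> exists2 k, (k < p ^ f)%N & v (x - g k) < 1) ->
  (forall k l, (k < p ^ f)%N -> (l < p ^ f)%N -> v (g k - g l) < 1 -> k = l) ->
  residue_degree p v = f.
Proof.
move=> hv p1 g_le1 g_surj g_inj.
pose coset x := [set y | v (y - x) < 1]%classic.
have coset_eq x y : v (x - y) < 1 -> coset x = coset y.
  move=> hxy; apply/seteqP; split=> z; rewrite /coset /= => hz.
    by rewrite -(subrKA x); apply: absD_lt.
  by rewrite -(subrKA y); apply: absD_lt => //; rewrite abs_distC.
have coset_refl x : coset x x by rewrite /coset /= subrr (abs0 hv) ltr01.
have card_residue : (residue_field v #= `I_(p ^ f))%card.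
  have -> : residue_field v = [set (coset \o g) k | k in `I_(p ^ f)]%classic.
    apply/seteqP; split=> _ [x hx <-].
      have [k hk hxk] := g_surj x hx.
      by exists k => //; apply/esym/coset_eq.
    by exists (g x) => //; apply: g_le1.
  apply: inj_card_eq => k l; rewrite !inE /= => hk hl hkl; apply: g_inj => //.
  by have := coset_refl (g k); rewrite hkl.
(* [xget] may return any admissible exponent; comparing cardinalities, with [1 < p], forces it to be
   [f]. *)
apply: xget_unique => // f' hf'.
have /card_eq_II h : (`I_(p ^ f') #= `I_(p ^ f))%card.
  by apply: card_eq_trans card_residue; rewrite card_eq_sym.
by apply/eqP; rewrite -(eqn_exp2l _ _ p1) h.
Qed.

(** Newton's iteration for [X^m - 1], started at [x], yields a root, so the set in [omega] is
    inhabited and [xget] does not fall back on 0. *)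
Lemma omegaP (R : realType) (p : nat) (K : fieldType) (v : K -> R) (x : K) :
  is_nonarch_abs v -> cauchy_complete v ->
  (0 < p ^ residue_degree p v - 1)%N ->
  v (p ^ residue_degree p v - 1)%:R = 1 -> v x = 1 ->
  v (x ^+ (p ^ residue_degree p v - 1) - 1) < 1 ->
  omega p v x ^+ (p ^ residue_degree p v - 1) = 1 /\ v (omega p v x - x) < 1.
Proof.
move=> hv cv m0 vm vx hx; have [w hw] := hensel_root hv cv m0 vm vx hx.
by rewrite /omega; case: xgetP => [y _ //|/(_ w)/(_ hw)].
Qed.

(** * The field [K] and the unit [phi] *)

Section QuadraticExtension.
Variables (R : realType) (p : nat) (Qp : fieldType) (vp : Qp -> R).
Variables (K : fieldExtType Qp) (v : K -> R) (sqrt5 : K).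
Hypotheses (hp : prime p) (hp2 : p <> 2%N) (hp5 : p <> 5%N).
Hypotheses (hQp : is_Qp p vp) (hK : is_Qp_sqrt5 vp v sqrt5).

Let hv := sqrt5_abs hK.
Let hvp := Qp_abs hQp.
Let vA := sqrt5_extends hK.

Let in_algE (a b : Qp) : v (a%:A - b%:A) = vp (a - b).
Proof. by rewrite -vA scalerBl. Qed.

Lemma abs_natK n : v n%:R = vp n%:R.
Proof. by rewrite -vA scaler_nat. Qed.

Lemma absK_nat_lt1 n : (v n%:R < 1) = (p %| n)%N.
Proof. by rewrite abs_natK (Qp_abs_nat_lt1 hp hQp). Qed.

Lemma absK_nat_eq1 n : ~~ (p %| n)%N -> v n%:R = 1.
Proof. by move=> hn; apply/eqP; rewrite abs_natK (Qp_abs_nat_eq1 hp hQp). Qed.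

Lemma absK_pexp_sub1 f : (0 < f)%N -> v (p ^ f - 1)%:R = 1.
Proof.
move=> f0; apply: absK_nat_eq1; rewrite dvdn_subr ?dvdn_exp ?expn_gt0 ?(prime_gt0 hp) //.
by rewrite dvdn1 neq_ltn prime_gt1 ?orbT.
Qed.

Lemma abs_sqrt5 : v sqrt5 = 1.
Proof.
apply/eqP; rewrite -(abs_expr_eq1 hv _ (ltn0Sn 1)) (sqrt5_sqr hK) absK_nat_eq1 //.
exact: prime_ndvd5.
Qed.

Let p_ndvd2 : ~~ (p %| 2)%N.
Proof. by rewrite dvdn_prime2 //; apply/eqP. Qed.

Let two_neq0 : 2%:R != 0 :> K.
Proof.
apply/eqP => h; have := absK_nat_eq1 p_ndvd2.
by rewrite h (abs0 hv) => /eqP; rewrite eq_sym oner_eq0.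
Qed.

Let phi_bar : K := (1 - sqrt5) / 2%:R.

Lemma phi_trace : phi sqrt5 + phi_bar = 1.
Proof. by rewrite /phi /phi_bar; field. Qed.

Lemma phi_norm : phi sqrt5 * phi_bar = -1.
Proof.
have four_neq0 : 4%:R != 0 :> K by rewrite (natrM _ 2 2) mulf_neq0.
have -> : phi sqrt5 * phi_bar = (1 - sqrt5 ^+ 2) / 4%:R.
  by rewrite /phi /phi_bar; field; rewrite two_neq0 four_neq0.
by rewrite (sqrt5_sqr hK); field.
Qed.

Lemma phi_sub_bar : phi sqrt5 - phi_bar = sqrt5.
Proof. by rewrite /phi /phi_bar; field. Qed.

(** Both [phi] and its conjugate are integral since 2 is a unit, and their product is [-1], so
    neither can have absolute value below 1. *)
Lemma abs_phi : v (phi sqrt5) = 1.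
Proof.
have half x : v x <= 1 -> v (x / 2%:R) <= 1.
  by move=> hx; rewrite (nonarch_mul hv) (absV hv) absK_nat_eq1 // invr1 mulr1.
have h1 : v (phi sqrt5) <= 1.
  by apply/half/absD_le; rewrite ?abs1 ?abs_sqrt5.
have h2 : v phi_bar <= 1 by apply/half/absB_le; rewrite ?abs1 ?abs_sqrt5.
apply/le_anti; rewrite h1 /= -(abs1 hv) -(absN hv 1) -phi_norm (nonarch_mul hv).
by rewrite ler_piMr // (nonarch_ge0 hv).
Qed.

(** For even [n] the [n]-th powers of [phi] and [phi_bar] are mutually inverse, so [phi^(2n) - 1] is
    Binet's difference times the unit [phi^n]. *)
Lemma abs_fib_even n : ~~ odd n -> v (fib n)%:R = v (phi sqrt5 ^+ (2 * n) - 1).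
Proof.
move=> n_even.
have hn : phi sqrt5 ^+ n * phi_bar ^+ n = 1.
  by rewrite -exprMn phi_norm -signr_odd (negPf n_even).
have -> : phi sqrt5 ^+ (2 * n) - 1 = (fib n)%:R * sqrt5 * phi sqrt5 ^+ n.
  rewrite -[X in _ * X * _]phi_sub_bar (fib_binet _ phi_trace phi_norm) mulrBl.
  by rewrite [phi_bar ^+ n * _]mulrC hn mul2n -addnn exprD.
by rewrite !(nonarch_mul hv) (absX hv) abs_phi abs_sqrt5 expr1n !mulr1.
Qed.

(** [m] stands for [p^f - 1], so that both residue degrees share this proof. *)
Lemma abs_fib_omega m :
  omega p v (phi sqrt5) ^+ m = 1 -> v m%:R = 1 ->
  v (omega p v (phi sqrt5) - phi sqrt5) < 1 ->
  v ((fib `|p%:Z - epsilon p|%N)%:R) =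
  v (phi sqrt5 / omega p v (phi sqrt5) - 1).
Proof.
set w := omega _ _ _; set n := `|_|%N => wm vm wphi.
have vw : v w = 1 by apply: abs_eq1_near wphi abs_phi.
have w0 : w != 0 by apply/eqP => w0; move/eqP: vw; rewrite w0 (abs0 hv) eq_sym oner_eq0.
have fibE := abs_fib_even (odd_index hp hp2).
have w2n : w ^+ (2 * n) = 1.
  apply: (root1_near1 hv _ vm); first by rewrite exprAC wm expr1n.
  rewrite -(subrKA (phi sqrt5 ^+ (2 * n))); apply: absD_lt => //.
    by apply: abs_subX_lt1; rewrite ?vw ?abs_phi.
  by rewrite -fibE absK_nat_lt1 dvdn_fib_prime.
have -> : v (fib n)%:R = v ((phi sqrt5 / w) ^+ (2 * n) - 1).
  by rewrite fibE [in RHS]expr_div_n w2n divr1.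
apply: abs_expr_sub1 => //; last exact/absK_nat_eq1/ndvd_double_index.
have -> : phi sqrt5 / w - 1 = (phi sqrt5 - w) / w by rewrite mulrBl divff.
by rewrite (nonarch_mul hv) (absV hv) vw invr1 mulr1 abs_distC.
Qed.

Lemma sqrt5_coord (x : K) : exists a b : Qp, x = a%:A + b *: sqrt5.
Proof.
have /Fadjoin1_polyP[q ->] : x \in <<1; sqrt5>>%VS by rewrite (sqrt5_gen hK) memvf.
elim/poly_ind: q => [|q c [a [b IH]]].
  by exists 0, 0; rewrite rmorph0 horner0 !scale0r addr0.
(* One Horner step: [(a + b sqrt5) sqrt5 + c = (5 b + c) + a sqrt5]. *)
exists (5%:R * b + c), a.
rewrite rmorphD rmorphM /= map_polyX map_polyC /= !hornerE IH mulrDl -scalerAl mul1r.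
rewrite -scalerAl -expr2 (sqrt5_sqr hK) scalerDl -mulr_natl.
by rewrite mulr_natl -scaler_nat scalerA [b * _]mulrC; ring.
Qed.

(** Common end of both cases: each supplies its representatives [g], completeness, and the
    congruence that starts Newton's iteration at [phi]. *)
Lemma abs_fib_of_residues f (g : nat -> K) : (0 < f)%N -> cauchy_complete v ->
  (forall k, v (g k) <= 1) ->
  (forall x, v x <= 1 -> exists2 k, (k < p ^ f)%N & v (x - g k) < 1) ->
  (forall k l, (k < p ^ f)%N -> (l < p ^ f)%N -> v (g k - g l) < 1 -> k = l) ->
  v (phi sqrt5 ^+ (p ^ f - 1) - 1) < 1 ->
  v ((fib `|p%:Z - epsilon p|%N)%:R) =
  v (phi sqrt5 / omega p v (phi sqrt5) - 1).
Proof.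
move=> f0 cv g_le1 g_surj g_inj hphi; have p1 := prime_gt1 hp.
have degE := residue_degreeE hv p1 g_le1 g_surj g_inj.
have [] := @omegaP _ p _ _ (phi sqrt5) hv cv; rewrite ?degE ?absK_pexp_sub1 ?abs_phi //.
  by rewrite subn_gt0 -[X in (X < _)%N](exp1n f) ltn_exp2r.
by move=> wm; apply: abs_fib_omega wm _; apply: absK_pexp_sub1.
Qed.

(** * The case where [sqrt5] lies in [Qp] *)

Lemma cauchy_complete_base : (exists a : Qp, sqrt5 = a%:A) -> cauchy_complete v.
Proof.
move=> [s hs] u hu.
have /choice[a ha] n : exists a : Qp, u n = a%:A.
  have [a [b ->]] := sqrt5_coord (u n); exists (a + b * s).
  by rewrite hs scalerA -scalerDl.
have /(Qp_complete hQp)[l hl] : is_cauchy vp a.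
  move=> e /hu[N hN]; exists N => m n hm hn.
  by rewrite -in_algE -!ha hN.
exists l%:A => e /hl[N hN]; exists N => n hn.
by rewrite ha in_algE hN.
Qed.

Lemma abs_fib_split : (exists a : Qp, sqrt5 = a%:A) ->
  v ((fib `|p%:Z - epsilon p|%N)%:R) =
  v (phi sqrt5 / omega p v (phi sqrt5) - 1).
Proof.
move=> hs; have [s sE] := hs.
have g_surj x : v x <= 1 -> exists2 k, (k < p)%N & v (x - k%:R) < 1.
  have [a [b ->]] := sqrt5_coord x.
  rewrite sE scalerA -scalerDl vA => /(Qp_residue hp hQp)[k hk hxk].
  by exists k; rewrite // -scaler_nat in_algE.
apply: (@abs_fib_of_residues 1 (fun k => k%:R)) => //; rewrite ?expn1.
- exact: cauchy_complete_base.
- by move=> k; apply: abs_nat_le1.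
- move=> k l hk hl; rewrite -!scaler_nat in_algE.
  exact: (Qp_residue_inj hp hQp).
(* [phi] is congruent to an integer [k] prime to [p], and Fermat's little theorem applies to [k]. *)
have [|k hk hphi] := g_surj (phi sqrt5); first by rewrite abs_phi.
have vk : v k%:R = 1 by apply: (abs_eq1_near hv _ abs_phi); rewrite abs_distC.
have kp : coprime k p.
  by rewrite coprime_sym prime_coprime // -absK_nat_lt1 vk ltxx.
rewrite -(subrKA (k%:R ^+ (p - 1))); apply: absD_lt => //.
  by apply: abs_subX_lt1; rewrite ?abs_phi ?vk.
have k1 : (0 < k ^ (p - 1))%N.
  rewrite expn_gt0; case: k kp vk {hk hphi} => // _.
  by rewrite (abs0 hv) => /eqP; rewrite eq_sym oner_eq0.
rewrite -natrX -(natrB _ k1) absK_nat_lt1 -eqn_mod_dvd //.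
by apply/eqP; have := Euler_exp_totient kp; rewrite totient_prime // subn1.
Qed.

(** * The case where [sqrt5] does not lie in [Qp] *)

Section Inert.
Hypothesis nsqrt5 : forall a : Qp, sqrt5 <> a%:A.

(* If [sqrt5] were congruent to some [c] in [Qp], Newton's iteration from [c]
   would give a square root of 5 in [Qp]. *)
Lemma abs_sqrt5_sub_ge1 (c : Qp) : 1 <= v (sqrt5 - c%:A).
Proof.
rewrite leNgt; apply/negP => hc.
have vc : vp c = 1.
  by rewrite -vA; apply: (abs_eq1_near hv _ abs_sqrt5); rewrite abs_distC.
have sqrA (a : Qp) : a%:A ^+ 2 = (a ^+ 2)%:A :> K by rewrite exprZn expr1n.
have h5 : vp (c ^+ 2 - 5%:R) < 1.
  rewrite -vA scalerBl -sqrA scaler_nat -(sqrt5_sqr hK).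
  by apply: abs_subX_lt1; rewrite ?vA ?vc ?abs_sqrt5 // abs_distC.
have v2 : vp 2%:R = 1 by apply/eqP; rewrite (Qp_abs_nat_eq1 hp hQp).
have [w [hw _]] := hensel_root hvp (Qp_complete hQp) (ltn0Sn 1) v2 vc h5.
have : sqrt5 ^+ 2 == w%:A ^+ 2 by rewrite sqrA hw (sqrt5_sqr hK) scaler_nat.
rewrite eqf_sqr => /orP[] /eqP; first exact: nsqrt5.
by rewrite -scaleNr; apply: nsqrt5.
Qed.

(** For nonzero [b], factor it out: the cofactor [sqrt5 - (-a/b)] has absolute value at least 1 by
    [abs_sqrt5_sub_ge1]. *)
Lemma abs_coord2_le (a b : Qp) : vp b <= v (a%:A + b *: sqrt5).
Proof.
have [->|b0] := eqVneq b 0; first by rewrite (abs0 hvp) (nonarch_ge0 hv).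
have -> : a%:A + b *: sqrt5 = b%:A * (sqrt5 - (- (b^-1 * a))%:A).
  by rewrite -scalerAl mul1r scalerBr scalerA mulrN mulVKf // scaleNr opprK addrC.
by rewrite (nonarch_mul hv) vA ler_peMr ?(nonarch_ge0 hvp) ?abs_sqrt5_sub_ge1.
Qed.

Lemma abs_scale_sqrt5 (b : Qp) : v (b *: sqrt5) = vp b.
Proof. by rewrite -mulr_algl (nonarch_mul hv) vA abs_sqrt5 mulr1. Qed.

Lemma abs_coord1_le (a b : Qp) : vp a <= v (a%:A + b *: sqrt5).
Proof.
rewrite -[vp a]vA -[X in v X <= _](addrK (b *: sqrt5)).
by apply: (absB_le hv) => //; rewrite abs_scale_sqrt5 abs_coord2_le.
Qed.

Lemma cauchy_complete_quadratic : cauchy_complete v.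
Proof.
move=> u hu.
have /choice[ab hab] n : exists ab : Qp * Qp, u n = ab.1%:A + ab.2 *: sqrt5.
  by have [a [b ->]] := sqrt5_coord (u n); exists (a, b).
have uB m n : u m - u n = ((ab m).1 - (ab n).1)%:A + ((ab m).2 - (ab n).2) *: sqrt5.
  by rewrite !hab !scalerBl addrACA -opprD.
have /(Qp_complete hQp)[l1 hl1] : is_cauchy vp (fun n => (ab n).1).
  move=> e /hu[N hN]; exists N => m n hm hn; apply: le_lt_trans (hN m n hm hn).
  by rewrite uB abs_coord1_le.
have /(Qp_complete hQp)[l2 hl2] : is_cauchy vp (fun n => (ab n).2).
  move=> e /hu[N hN]; exists N => m n hm hn; apply: le_lt_trans (hN m n hm hn).
  by rewrite uB abs_coord2_le.
exists (l1%:A + l2 *: sqrt5) => e e0.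
have [N1 hN1] := hl1 e e0; have [N2 hN2] := hl2 e e0.
exists (maxn N1 N2) => n; rewrite geq_max => /andP[/hN1 h1 /hN2 h2].
rewrite hab opprD addrACA -!scalerBl.
by apply: (absD_lt hv); rewrite ?vA ?abs_scale_sqrt5.
Qed.

Lemma abs_fib_inert :
  v ((fib `|p%:Z - epsilon p|%N)%:R) =
  v (phi sqrt5 / omega p v (phi sqrt5) - 1).
Proof.
have p0 := prime_gt0 hp.
(* The two base-[p] digits of [k < p^2] are the coordinates of the residue: [i + j sqrt5] has index
   [i p + j]. *)
pose g k : K := (k %/ p)%:R%:A + (k %% p)%:R *: sqrt5.
apply: (@abs_fib_of_residues 2 g) => //.
- exact: cauchy_complete_quadratic.
- move=> k; apply: (absD_le hv); rewrite ?vA ?abs_scale_sqrt5; exact: abs_nat_le1.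
- move=> x; have [a [b ->]] := sqrt5_coord x => hx.
  have [i hi hai] := Qp_residue hp hQp (le_trans (abs_coord1_le a b) hx).
  have [j hj hbj] := Qp_residue hp hQp (le_trans (abs_coord2_le a b) hx).
  exists (i * p + j)%N; first by rewrite -mulnn; nia.
  rewrite /g divnMDl // modnMDl divn_small // modn_small // addn0.
  rewrite opprD addrACA -!scalerBl.
  by apply: (absD_lt hv); rewrite ?vA ?abs_scale_sqrt5.
- move=> k l hk hl; rewrite /g opprD addrACA -!scalerBl => hkl.
  rewrite (divn_eq k p) (divn_eq l p); congr (_ * _ + _)%N.
    apply: (Qp_residue_inj hp hQp); rewrite ?ltn_divLR ?mulnn //.
    exact: le_lt_trans (abs_coord1_le _ _) hkl.
  apply: (Qp_residue_inj hp hQp); rewrite ?ltn_mod //.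
  exact: le_lt_trans (abs_coord2_le _ _) hkl.
have /dvdnP[m ->] := double_index_dvd hp hp2.
rewrite mulnC exprM -[X in _ - X](expr1n _ m).
apply: abs_subX_lt1; rewrite ?(absX hv) ?abs_phi ?(abs1 hv) ?expr1n //.
by rewrite -abs_fib_even ?odd_index // absK_nat_lt1 dvdn_fib_prime.
Qed.

End Inert.

End QuadraticExtension.

Theorem theorem10 (R : realType) (p : nat)
    (Qp : fieldType) (vp : Qp -> R)
    (K : fieldExtType Qp) (v : K -> R) (sqrt5 : K)
    (hp : prime p) (hp2 : p <> 2%N) (hp5 : p <> 5%N)
    (hQp : is_Qp p vp) (hK : is_Qp_sqrt5 vp v sqrt5) :
  v ((fib `|p%:Z - epsilon p|%N)%:R) =
  v (phi sqrt5 / omega p v (phi sqrt5) - 1).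
Proof.
(* Deciding on [sqrt5] itself rather than on [p] modulo 5 avoids any appeal to quadratic
   reciprocity. *)
have [hs|ns] := EM (exists a : Qp, sqrt5 = a%:A).
  exact: (abs_fib_split hp hp2 hp5 hQp hK hs).
apply: (abs_fib_inert hp hp2 hp5 hQp hK) => a ha; apply: ns.
by exists a.
Qed.
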